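(* Let $\mathfrak{g}=\mathrm{Lie}\big(\mathfrak{scont}(J^1(\mathbb{R}^n)),\mathfrak{pdiff}(J^1(\mathbb{R}^n))\big)$ be the smallest Lie subalgebra of $\big(C^\infty(J^1(\mathbb{R}^n)),[\cdot,\cdot]\big)$ (with $[\cdot,\cdot]$ the contact-Jacobi bracket) containing the strict contact Hamiltonians and the prolonged Hamiltonians. Then $\mathfrak{g}$ contains all polynomial-in-$p$ Hamiltonians, i.e. $P^{(k)}(J^1(\mathbb{R}^n))\subset\mathfrak{g}$ for all $k\in\mathbb{N}$. Therefore the closure $\overline{\mathfrak{g}}$ is dense in $\mathfrak{cont}(J^1(\mathbb{R}^n))\cong C^\infty(J^1(\mathbb{R}^n))$ in the $C^r$ topology on compact sets; that is, for every $r<\infty$, every compact $U\subset J^1(\mathbb{R}^n)$, every $H\in C^\infty(J^1(\mathbb{R}^n))$ and every $\epsilon>0$ there is $K\in\mathfrak{g}$ with $\|H-K\|_{C^r(U)}<\epsilon$.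
   Context: $J^1(\mathbb{R}^n)\cong\mathbb{R}^{2n+1}$ has global coordinates $(x,u,p)=(x^1,\dots,x^n,u,p_1,\dots,p_n)$ and contact form $\alpha=du-p_i\,dx^i$ (summation convention). Contact vector fields (those $X$ with $\mathcal{L}_X\alpha=\zeta\alpha$ for some function $\zeta$) form the Lie algebra $\mathfrak{cont}(J^1(\mathbb{R}^n))$, which is identified with $C^\infty(J^1(\mathbb{R}^n))$ through $H\mapsto X_H$, $$X_H=\frac{\partial H}{\partial p_i}\frac{\partial}{\partial x^i}-\Big(\frac{\partial H}{\partial x^i}+p_i\frac{\partial H}{\partial u}\Big)\frac{\partial}{\partial p_i}+\Big(p_i\frac{\partial H}{\partial p_i}-H\Big)\frac{\partial}{\partial u}.$$ The contact-Jacobi bracket on $C^\infty(J^1(\mathbb{R}^n))$ is $$[H,K]=\{H,K\}+\frac{\partial H}{\partial u}\Big(K-p_i\frac{\partial K}{\partial p_i}\Big)-\frac{\partial K}{\partial u}\Big(H-p_i\frac{\partial H}{\partial p_i}\Big),\qquad \{H,K\}=\sum_{i=1}^n\Big(\frac{\partial H}{\partial p_i}\frac{\partial K}{\partial x^i}-\frac{\partial H}{\partial x^i}\frac{\partial K}{\partial p_i}\Big).$$ Strict contact Hamiltonians: $\mathfrak{scont}(J^1(\mathbb{R}^n))=\{H\in C^\infty(J^1(\mathbb{R}^n)):\partial H/\partial u=0\}$. Prolonged Hamiltonians: $\mathfrak{pdiff}(J^1(\mathbb{R}^n))=\{H: H(x,u,p)=f(x,u)+g^i(x,u)p_i,\ f,g^i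 \text{ smooth}\}$. Polynomial-in-$p$ Hamiltonians of degree at most $k$: $P^{(k)}(J^1(\mathbb{R}^n))=\{H: H(x,u,p)=\sum_{|\alpha|\le k}f_\alpha(x,u)p^\alpha,\ f_\alpha\text{ smooth}\}$ (here $\alpha$ is a multi-index). Equivalently, $\mathfrak{g}=\bigcup_{k\ge0}\mathfrak{g}_k$ with $\mathfrak{g}_0=\mathfrak{scont}+\mathfrak{pdiff}$ and $\mathfrak{g}_{k+1}=\mathfrak{g}_k+[\mathfrak{scont},\mathfrak{g}_k]+[\mathfrak{pdiff},\mathfrak{g}_k]$, where $[\mathfrak{a},\mathfrak{b}]=\mathrm{span}\{[a,b]:a\in\mathfrak{a},b\in\mathfrak{b}\}$. The norm is $\|F\|_{C^r(U)}=\max_{0\le k\le r}\sup_{z\in U}\|D^kF(z)\|$. *)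

(* Defs.v *)
From HB Require Import structures.
From mathcomp Require Import all_boot all_order all_algebra.
From mathcomp Require Import all_classical all_reals all_analysis.
Set Implicit Arguments.
Unset Strict Implicit.
Unset Printing Implicit Defensive.
Import Order.TTheory GRing.Theory Num.Theory numFieldNormedType.Exports.
Local Open Scope classical_set_scope.
Local Open Scope ring_scope.

(* A point (x, u, p) of J^1(R^n) is z with z.1 = (x, u) in J^0(R^n),
   z.1.1 = x, z.1.2 = u and z.2 = p. *)
Notation J0 R n := ('rV[R]_n * R)%type.
Notation J1 R n := ('rV[R]_n * R * 'rV[R]_n)%type.

Section Smooth.
Context {R : realType} {V : normedModType R}.

(* In finite dimension, Df is C^k as a map to the dual of V exactly when
   Df(.)(v) is C^k for every v. *)
Fixpoint Ck (k : nat) (f : V -> R) : Prop :=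
  match k with
  | 0 => continuous f
  | k'.+1 => (forall z, differentiable f z) /\
             (forall v, Ck k' (fun z => 'D_v f z))
  end.

Definition smooth (f : V -> R) : Prop := forall k, Ck k f.

(* For smooth f this is the value at (v_1, ..., v_k) of the symmetric
   k-linear form D^k f (z). *)
Definition iter_derive (vs : seq V) (f : V -> R) : V -> R :=
  foldr (fun v g z => 'D_v g z) f vs.

(* Operator norm of D^k f (z).  It is extended-real valued so that an unbounded
   form has norm +oo (the supremum in R would then be 0).  On J^1(R^n) the norm
   of the v_i is the max norm; any other choice gives an equivalent C^r norm. *)
Definition norm_Dk (k : nat) (f : V -> R) (z : V) : \bar R :=
  ereal_sup [set `|iter_derive vs f z|%:E | vs in
    [set vs : k.-tuple V | forall i, `|tnth vs i| <= 1]].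

Definition Cr_norm (r : nat) (U : set V) (f : V -> R) : \bar R :=
  \big[maxe/0%E]_(k < r.+1) ereal_sup [set norm_Dk k f z | z in U].

End Smooth.

Section ContactHamiltonians.
Context {R : realType} {n : nat}.
Implicit Types (H K : J1 R n -> R) (g : set (J1 R n -> R)).

Definition dx (i : 'I_n) H : J1 R n -> R :=
  fun z => 'D_((delta_mx 0 i, 0, 0) : J1 R n) H z.
Definition du H : J1 R n -> R :=
  fun z => 'D_((0, 1, 0) : J1 R n) H z.
Definition dp (i : 'I_n) H : J1 R n -> R :=
  fun z => 'D_((0, 0, delta_mx 0 i) : J1 R n) H z.

Definition poisson H K : J1 R n -> R := fun z =>
  \sum_(i < n) (dp i H z * dx i K z - dx i H z * dp i K z).

(* H - p_i dH/dp_i *)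
Definition deg_defect H : J1 R n -> R := fun z =>
  H z - \sum_(i < n) z.2 0 i * dp i H z.

Definition contact_bracket H K : J1 R n -> R := fun z =>
  poisson H K z + du H z * deg_defect K z - du K z * deg_defect H z.

Definition scont : set (J1 R n -> R) :=
  [set H | smooth H /\ forall z, du H z = 0].

Definition pdiff : set (J1 R n -> R) :=
  [set H | exists (f : J0 R n -> R) (g : 'I_n -> J0 R n -> R),
    [/\ smooth f, forall i, smooth (g i) &
        forall z : J1 R n, H z = f z.1 + \sum_(i < n) g i z.1 * z.2 0 i]].

(* A multi-index of length at most k has all its entries at most k, hence the
   finite index type. *)
Definition poly_p (k : nat) : set (J1 R n -> R) :=
  [set H | exists f : {ffun 'I_n -> 'I_k.+1} -> J0 R n -> R,
    (forall a, smooth (f a)) /\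
    forall z : J1 R n, H z = \sum_(a : {ffun 'I_n -> 'I_k.+1} | (\sum_i a i <= k)%N)
                      f a z.1 * \prod_(i < n) z.2 0 i ^+ a i].

Definition lie_subalgebra g : Prop :=
  [/\ g `<=` [set H | smooth H],
      g (fun=> 0),
      forall (c : R) H K, g H -> g K -> g (fun z => c * H z + K z) &
      forall H K, g H -> g K -> g (contact_bracket H K)].

Definition lie_scont_pdiff : set (J1 R n -> R) :=
  smallest lie_subalgebra (scont `|` pdiff).

End ContactHamiltonians.

(* Main.v *)
Require Import Defs.
From HB Require Import structures.
From mathcomp Require Import all_boot all_order all_algebra.
From mathcomp Require Import all_classical all_reals all_analysis.
From mathcomp Require Import ring lra.
Set Implicit Arguments.
Unset Strict Implicit.
Unset Printing Implicit Defensive.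
Import Order.TTheory GRing.Theory Num.Theory numFieldNormedType.Exports.
Local Open Scope classical_set_scope.
Local Open Scope ring_scope.

(* For a = a(x, u) and a strict Hamiltonian K = K(x, p),
     [a p_j, x_j K] - [x_j a p_j, K] = a (K + p_j dK/dp_j).
   With K = p^alpha the right-hand side is (1 + alpha_j) a p^alpha, which gives
   all Hamiltonians polynomial in p.  With a = u^m, summing over j and adding
     [u^(m+1) / (m+1), K] = u^m (K - p_i dK/dp_i)
   gives (n + 1) u^m K.  Hence the Lie algebra contains every polynomial in u
   whose coefficients are arbitrary smooth functions of (x, p), and for the
   density it is enough to approximate in the single variable u: Bernstein
   polynomials in u commute with the derivatives in x and p, and u-derivatives
   are handled by approximating dH/du first and then integrating in u. *)

(** * Smooth functions on a normed space and their iterated directional derivatives *)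

Section SmoothTheory.
Context {R : realType} {V : normedModType R}.
Implicit Types (f g : V -> R) (v w z : V) (k : nat).

Lemma Ck_continuous k f : Ck k f -> continuous f.
Proof.
case: k => [//|k] [df _] z; exact: differentiable_continuous.
Qed.

Lemma CkW k f : Ck k.+1 f -> Ck k f.
Proof.
elim: k f => [|k IH] f; first exact: Ck_continuous.
by move=> [df Df]; split=> // v; apply: IH; apply: Df.
Qed.

Lemma smooth_continuous f : smooth f -> continuous f.
Proof. by move=> /(_ 0). Qed.

Lemma smooth_differentiable f z : smooth f -> differentiable f z.
Proof. by move=> /(_ 1%N) []. Qed.

Lemma smooth_derivable f z v : smooth f -> derivable f z v.
Proof. by move=> sf; apply/diff_derivable/smooth_differentiable. Qed.

Lemma smooth_derive f v : smooth f -> smooth (fun z => 'D_v f z).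
Proof. by move=> sf k; have [_] := sf k.+1; apply. Qed.

Lemma smooth_iter_derive vs f : smooth f -> smooth (iter_derive vs f).
Proof. by move=> sf; elim: vs => //= v vs IH; apply: smooth_derive. Qed.

Lemma derive_cst_fun v (c : R) : (fun z => 'D_v (fun=> c) z) = fun=> 0.
Proof. by apply/funext => z; rewrite derive_cst. Qed.

Lemma smooth_cst (c : R) : smooth (fun _ : V => c).
Proof.
move=> k; elim: k c => [|k IH] c; first exact: cst_continuous.
split=> [z|v]; first exact: differentiable_cst.
by rewrite derive_cst_fun.
Qed.

Lemma derive_add f g v z : smooth f -> smooth g ->
  'D_v (fun z => f z + g z) z = 'D_v f z + 'D_v g z.
Proof. by move=> sf sg; rewrite -deriveD//; apply: smooth_derivable. Qed.

Lemma derive_mul f g v z : smooth f -> smooth g ->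
  'D_v (fun z => f z * g z) z = 'D_v f z * g z + f z * 'D_v g z.
Proof.
move=> sf sg; rewrite deriveM; [|exact: smooth_derivable..].
by rewrite addrC [_ *: 'D_v f z]mulrC.
Qed.

Lemma Ck_add k f g : Ck k f -> Ck k g -> Ck k (fun z => f z + g z).
Proof.
elim: k f g => [|k IH] f g; first by move=> cf cg z; apply: continuousD; [exact: cf|exact: cg].
move=> [df Df] [dg Dg]; split=> [z|v]; first exact: differentiableD.
rewrite (_ : (fun z => _) = fun z => 'D_v f z + 'D_v g z).
  by apply: IH; [exact: Df|exact: Dg].
by apply/funext => z; rewrite -deriveD//; apply: diff_derivable.
Qed.

(** The Leibniz rule pairs a derivative of one factor with the other factor itself, so [CkW] first
    lowers the order of the undifferentiated factor. *)
Lemma Ck_mul k f g : Ck k f -> Ck k g -> Ck k (fun z => f z * g z).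
Proof.
elim: k f g => [|k IH] f g; first by move=> cf cg z; apply: continuousM; [exact: cf|exact: cg].
move=> /[dup] /CkW Cf [df Df] /[dup] /CkW Cg [dg Dg].
split=> [z|v]; first exact: differentiableM.
rewrite (_ : (fun z => _) = fun z => f z * 'D_v g z + g z * 'D_v f z).
  by apply: Ck_add; apply: IH => //; [exact: Dg|exact: Df].
by apply/funext => z; rewrite -deriveM//; apply: diff_derivable.
Qed.

Lemma smooth_add f g : smooth f -> smooth g -> smooth (fun z => f z + g z).
Proof. by move=> sf sg k; apply: Ck_add. Qed.

Lemma smooth_mul f g : smooth f -> smooth g -> smooth (fun z => f z * g z).
Proof. by move=> sf sg k; apply: Ck_mul. Qed.

Lemma smooth_scale (c : R) f : smooth f -> smooth (fun z => c * f z).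
Proof. exact/smooth_mul/smooth_cst. Qed.

Lemma smooth_sub f g : smooth f -> smooth g -> smooth (fun z => f z - g z).
Proof.
move=> sf sg; rewrite (_ : (fun z => _) = fun z => f z + (-1) * g z).
  exact/smooth_add/smooth_scale.
by apply/funext => z; rewrite mulN1r.
Qed.

Lemma smooth_sum (I : Type) (r : seq I) (P : pred I) (F : I -> V -> R) :
  (forall i, smooth (F i)) -> smooth (fun z => \sum_(i <- r | P i) F i z).
Proof.
move=> sF; elim: r => [|i r IH].
  by under eq_fun do rewrite big_nil; apply: smooth_cst.
under eq_fun do rewrite big_cons.
by case: (P i) => //; apply: smooth_add.
Qed.

Lemma smooth_exp f k : smooth f -> smooth (fun z => f z ^+ k).
Proof.
move=> sf; elim: k => [|k IH].
  by under eq_fun do rewrite expr0; apply: smooth_cst.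
by under eq_fun do rewrite exprS; apply: smooth_mul.
Qed.

Lemma smooth_prod (I : Type) (r : seq I) (P : pred I) (F : I -> V -> R) :
  (forall i, smooth (F i)) -> smooth (fun z => \prod_(i <- r | P i) F i z).
Proof.
move=> sF; elim: r => [|i r IH].
  by under eq_fun do rewrite big_nil; apply: smooth_cst.
under eq_fun do rewrite big_cons.
by case: (P i) => //; apply: smooth_mul.
Qed.

Lemma derive_scale (c : R) f v z : smooth f ->
  'D_v (fun z => c * f z) z = c * 'D_v f z.
Proof.
by move=> sf; rewrite derive_mul//; [rewrite derive_cst mul0r add0r|exact: smooth_cst].
Qed.

Lemma derive_sub f g v z : smooth f -> smooth g ->
  'D_v (fun z => f z - g z) z = 'D_v f z - 'D_v g z.
Proof. by move=> sf sg; rewrite -deriveB//; apply: smooth_derivable. Qed.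

Lemma derive_exp f k v z : smooth f ->
  'D_v (fun z => f z ^+ k.+1) z = k.+1%:R * f z ^+ k * 'D_v f z.
Proof.
move=> sf; elim: k => [|k IH]; first by rewrite expr0 !mul1r.
under [X in 'D_v X z]eq_fun do rewrite exprS.
rewrite derive_mul//; last exact: smooth_exp.
by rewrite IH !exprS [in RHS]mulrSr; ring.
Qed.

Lemma derive_prod_eq0 (I : Type) (r : seq I) (P : pred I) (F : I -> V -> R) v z :
  (forall i, smooth (F i)) -> (forall i, P i -> forall y, 'D_v (F i) y = 0) ->
  'D_v (fun z => \prod_(i <- r | P i) F i z) z = 0.
Proof.
move=> sF dF; elim: r => [|i r IH].
  by under [X in 'D__ X _]eq_fun do rewrite big_nil; rewrite derive_cst.
under [X in 'D__ X _]eq_fun do rewrite big_cons.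
case Pi: (P i) => //; rewrite derive_mul//; last exact: smooth_prod.
by rewrite IH dF// mul0r mulr0 addr0.
Qed.

(** For differentiable [f] the directional derivative is the differential applied to the direction,
    hence linear in it. *)
Lemma derive_sum_dir (I : Type) (r : seq I) (c : I -> R) (e : I -> V) f z :
  smooth f ->
  'D_(\sum_(i <- r) c i *: e i) f z = \sum_(i <- r) c i * 'D_(e i) f z.
Proof.
move=> sf; have df := smooth_differentiable z sf.
rewrite deriveE// linear_sum; apply: eq_bigr => i _.
by rewrite linearZ/= deriveE.
Qed.

Lemma iter_derive_add vs f g : smooth f -> smooth g ->
  iter_derive vs (fun z => f z + g z) =
  fun z => iter_derive vs f z + iter_derive vs g z.
Proof.
move=> sf sg; elim: vs => //= v vs ->; apply/funext => z.
by rewrite derive_add//; apply: smooth_iter_derive.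
Qed.

Lemma iter_derive_scale vs (c : R) f : smooth f ->
  iter_derive vs (fun z => c * f z) = fun z => c * iter_derive vs f z.
Proof.
move=> sf; elim: vs => //= v vs ->; apply/funext => z.
by rewrite derive_scale//; apply: smooth_iter_derive.
Qed.

Lemma iter_derive_sub vs f g : smooth f -> smooth g ->
  iter_derive vs (fun z => f z - g z) =
  fun z => iter_derive vs f z - iter_derive vs g z.
Proof.
move=> sf sg; elim: vs => //= v vs ->; apply/funext => z.
by rewrite derive_sub//; apply: smooth_iter_derive.
Qed.

Lemma iter_derive_sum vs (I : Type) (r : seq I) (F : I -> V -> R) :
  (forall i, smooth (F i)) ->
  iter_derive vs (fun z => \sum_(i <- r) F i z) =
  fun z => \sum_(i <- r) iter_derive vs (F i) z.
Proof.
move=> sF; elim: r => [|i r IH].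
  under [X in iter_derive _ X]eq_fun do rewrite big_nil.
  apply/funext => z; rewrite big_nil; elim: vs z => // v vs IH z.
  by rewrite /= (_ : iter_derive vs _ = cst 0) ?derive_cst//; apply/funext.
under [X in iter_derive _ X]eq_fun do rewrite big_cons.
rewrite iter_derive_add//; last exact: smooth_sum.
by rewrite IH; apply/funext => z; rewrite big_cons.
Qed.

Lemma iter_derive_cat vs ws f :
  iter_derive (vs ++ ws) f = iter_derive vs (iter_derive ws f).
Proof. exact: foldr_cat. Qed.

Lemma derive_line f v z (t : R) : 'D_1 (fun s : R => f (z + s *: v)) t = 'D_v f (z + t *: v).
Proof.
rewrite /derive.
under eq_fun do rewrite /= [_ *: 1]mulr1 scalerDl addrCA.
by [].
Qed.

Lemma derivable_line f v z (t : R) : smooth f ->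
  derivable (fun s : R => f (z + s *: v)) t 1.
Proof.
move=> sf; have := @smooth_derivable f (z + t *: v) v sf; rewrite /derivable.
by under [in X in _ -> X]eq_fun do rewrite /= [_ *: 1]mulr1 scalerDl addrCA.
Qed.

(** This is the one-variable mean value theorem for s -> f (z + s v). The closed range of s makes t
    = 0 admissible. *)
Lemma mean_value f v z (t : R) : smooth f -> 0 <= t ->
  exists2 s, 0 <= s <= t & f (z + t *: v) - f z = 'D_v f (z + s *: v) * t.
Proof.
move=> sf t0.
have df (s : R) : is_derive s 1 (fun s : R => f (z + s *: v)) ('D_v f (z + s *: v)).
  by apply: DeriveDef; [exact: derivable_line|exact: derive_line].
have [|s s0t] := MVT_segment t0 (fun s _ => df s).
  apply: continuous_subspaceT => s; apply: differentiable_continuous.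
  exact/derivable1_diffP/derivable_line.
rewrite scale0r addr0 subr0 => E; by exists s.
Qed.

End SmoothTheory.

(** * Composition with a continuous affine map *)

Section AffineSubstitution.
Context {R : realType} {V W : normedModType R}.
Variables (L : V -> W) (c : W).
Hypothesis lL : linear L.

(** By linearity of [L], the difference quotients on both sides are the same function of the
    increment. *)
Lemma derive_affine (f : W -> R) v z :
  'D_v (fun z => f (L z + c)) z = 'D_(L v) f (L z + c).
Proof.
rewrite /derive.
under eq_fun do rewrite /= lL -addrA.
by [].
Qed.

Hypothesis cL : continuous L.

(** The derivative along v is the same substitution performed in ['D_(L v) f], so the induction on
    the order runs over all smooth f at once. *)
Lemma smooth_affine (f : W -> R) : smooth f -> smooth (fun z => f (L z + c)).
Proof.
have dL z : differentiable (fun z => L z + c) z.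
  apply: differentiableD; last exact: differentiable_cst.
  pose L' : {linear V -> W} := HB.pack L (GRing.isLinear.Build _ _ _ _ L lL).
  exact: (@linear_differentiable _ _ _ L').
move=> sf k; elim: k f sf => [|k IH] f sf.
  move=> z; apply: differentiable_continuous.
  exact/(differentiable_comp (dL z))/smooth_differentiable.
split=> [z|v]; first exact/(differentiable_comp (dL z))/smooth_differentiable.
under eq_fun do rewrite derive_affine.
exact: (IH (fun y => 'D_(L v) f y) (smooth_derive (L v) sf)).
Qed.

End AffineSubstitution.

(** * Continuous linear forms *)

Section LinearForms.
Context {R : realType} {V : normedModType R}.
Variable L : V -> R.
Hypotheses (lL : linear L) (cL : continuous L).

Let L' : {linear V -> R} := HB.pack L (GRing.isLinear.Build _ _ _ _ L lL).

Lemma derive_linear v z : 'D_v L z = L v.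
Proof.
rewrite (deriveE _ (@linear_differentiable _ _ _ L' z cL)).
by rewrite (@diff_lin _ _ _ L').
Qed.

Lemma smooth_linear : smooth L.
Proof.
move=> [//|k]; split=> [z|v]; first exact: (@linear_differentiable _ _ _ L').
under eq_fun do rewrite derive_linear.
exact: smooth_cst.
Qed.

End LinearForms.

(** * Symmetry of second derivatives *)

Section SymmetryOfDerivatives.
Context {R : realType} {V : normedModType R}.

(** Two uses of the mean value theorem: along v for the increment y -> f (y + t w) - f y, then along
    w for ['D_v f]. *)
Lemma second_difference (f : V -> R) v w z (t : R) : smooth f -> 0 <= t ->
  exists a b, [/\ 0 <= a <= t, 0 <= b <= t &
    f (z + t *: v + t *: w) - f (z + t *: v) - (f (z + t *: w) - f z) =
    'D_w (fun z => 'D_v f z) (z + a *: v + b *: w) * (t * t)].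
Proof.
move=> sf t0.
have strans : smooth (fun y => f (y + t *: w)).
  by apply: (@smooth_affine _ _ _ idfun) => // y; exact: cvg_id.
have [a at0 ->] := mean_value v z (smooth_sub strans sf) t0.
rewrite derive_sub// (@derive_affine _ _ _ idfun)//=.
have [b bt0 ->] := mean_value w (z + a *: v) (smooth_derive v sf) t0.
by exists a, b; rewrite mulrA.
Qed.

Lemma common_modulus (A B : V -> R) : continuous A -> continuous B ->
  forall z (e : R), 0 < e -> exists2 d : R, 0 < d &
    forall y, ball z d y -> `|A z - A y| < e /\ `|B z - B y| < e.
Proof.
move=> cA cB z e e0.
have [a /= a0 Aa] : nbhs_ball z [set y | `|A z - A y| < e].
  by apply/nbhs_ballP; move/cvgrPdist_lt: (cA z); apply.
have [b /= b0 Bb] : nbhs_ball z [set y | `|B z - B y| < e].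
  by apply/nbhs_ballP; move/cvgrPdist_lt: (cB z); apply.
exists (Num.min a b); first by rewrite lt_min a0.
move=> y zy; split; [apply: Aa|apply: Bb].
  by apply: le_ball zy; rewrite ge_min lexx.
by apply: le_ball zy; rewrite ge_min lexx orbT.
Qed.

(** The second difference is symmetric in v and w, so each mixed derivative, taken at some point
    near z, equals the same number divided by t^2. Continuity of both at z then forces equality. *)
Lemma derive_comm (f : V -> R) v w z : smooth f ->
  'D_v (fun z => 'D_w f z) z = 'D_w (fun z => 'D_v f z) z.
Proof.
have near_eq (e p q r : R) : `|p - r| < e / 2 -> `|q - r| < e / 2 -> `|p - q| <= e.
  by rewrite !ltr_norml ler_norml => /andP[? ?] /andP[? ?]; apply/andP; split; lra.
move=> sf.
pose A := 'D_v (fun z => 'D_w f z); pose B := 'D_w (fun z => 'D_v f z).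
have cA : continuous A by exact/smooth_continuous/smooth_derive/smooth_derive.
have cB : continuous B by exact/smooth_continuous/smooth_derive/smooth_derive.
apply/eqP; rewrite -subr_eq0 -normr_le0; apply/ler_addgt0Pr => e e0; rewrite add0r.
have e20 : 0 < e / 2 by rewrite divr_gt0.
have [d d0 near_z] := common_modulus cA cB z e20.
(* The summand 1 keeps [N] positive when v = w = 0, and the factor 2 in [t] makes t N = d / 2
   strictly smaller than d. *)
pose N := `|v| + `|w| + 1.
have N0 : 0 < N by rewrite ltr_wpDl// addr_ge0.
pose t := d / (2 * N).
have t0 : 0 < t by rewrite divr_gt0// mulr_gt0.
have in_ball a b v' w' : `|v'| + `|w'| + 1 = N -> 0 <= a <= t -> 0 <= b <= t ->
    ball z d (z + a *: v' + b *: w').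
  move=> NE /andP[a0 at0] /andP[b0 bt0].
  rewrite -ball_normE/= -addrA opprD addNKr normrN.
  have tN : t * N < d.
    rewrite /t -mulrA invfM -(mulrA 2^-1) mulVf ?gt_eqF// mulr1.
    by rewrite ltr_pdivrMr// ltr_pMr// ltr1n.
  apply: le_lt_trans tN; apply: (le_trans (ler_normD _ _)).
  rewrite !normrZ !ger0_norm// -NE -addrA mulrDr lerD ?ler_wpM2r//.
  by rewrite (le_trans (ler_wpM2r _ bt0))// ler_wpM2l ?lerDl// ltW.
have [a [b [at0 bt0 E1]]] := second_difference v w z sf (ltW t0).
have [a' [b' [at0' bt0' E2]]] := second_difference w v z sf (ltW t0).
have {}E : B (z + a *: v + b *: w) = A (z + a' *: w + b' *: v).
  apply: (@mulIf _ (t * t)); first by rewrite mulf_neq0// gt_eqF.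
  by rewrite -E1 -E2 [z + _ + _]addrAC; ring.
have [_ BE] := near_z _ (in_ball _ _ _ _ erefl at0 bt0).
have NE : `|w| + `|v| + 1 = N by rewrite /N [`|w| + _]addrC.
have [AE _] := near_z _ (in_ball _ _ _ _ NE at0' bt0').
by rewrite E in BE; exact: near_eq AE BE.
Qed.

Lemma iter_derive_derive vs v (f : V -> R) z : smooth f ->
  'D_v (iter_derive vs f) z = iter_derive vs (fun z => 'D_v f z) z.
Proof.
move=> sf; elim: vs z => //= w vs IH z.
rewrite derive_comm; last exact: smooth_iter_derive.
by congr ('D_w _ z); apply/funext.
Qed.

(** By symmetry any direction in the list can be made the first one applied to f; this is how a
    single u-derivative is split off later. *)
Lemma iter_derive_mid vs ws v (f : V -> R) z : smooth f ->
  iter_derive (vs ++ v :: ws) f z = iter_derive (vs ++ ws) (fun z => 'D_v f z) z.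
Proof.
move=> sf; rewrite !iter_derive_cat/=; congr (iter_derive vs _ z).
by apply/funext => y; rewrite iter_derive_derive.
Qed.

End SymmetryOfDerivatives.

(** * Coordinate functions on the jet space, and restriction to slices of constant u *)

Section Coordinates.
Context {R : realType} {n : nat}.
Implicit Types (z v : J1 R n) (j : 'I_n).

Definition xcoord j z : R := z.1.1 0 j.
Definition ucoord z : R := z.1.2.
Definition pcoord j z : R := z.2 0 j.

Let linear_xcoord j : linear (xcoord j).
Proof. by move=> a y z; rewrite /xcoord/= !mxE. Qed.

Let linear_ucoord : linear ucoord.
Proof. by []. Qed.

Let linear_pcoord j : linear (pcoord j).
Proof. by move=> a y z; rewrite /pcoord/= !mxE. Qed.

Let continuous_fst_fst : continuous (fun z => z.1.1).
Proof.
by move=> z; apply: (@continuous_comp _ _ _ fst fst); apply: cvg_fst.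
Qed.

Let continuous_xcoord j : continuous (xcoord j).
Proof.
move=> z; apply: (@continuous_comp _ _ _ (fun z => z.1.1) (fun x => x 0 j)).
  exact: continuous_fst_fst.
exact: coord_continuous.
Qed.

Let continuous_ucoord : continuous ucoord.
Proof.
by move=> z; apply: (@continuous_comp _ _ _ fst snd); [apply: cvg_fst|apply: cvg_snd].
Qed.

Let continuous_pcoord j : continuous (pcoord j).
Proof.
move=> z; apply: (@continuous_comp _ _ _ (fun z : J1 R n => z.2) (fun p => p 0 j)).
  exact: cvg_snd.
exact: coord_continuous.
Qed.

Lemma smooth_xcoord j : smooth (xcoord j).
Proof. exact: smooth_linear. Qed.

Lemma smooth_ucoord : smooth ucoord.
Proof. exact: smooth_linear. Qed.

Lemma smooth_pcoord j : smooth (pcoord j).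
Proof. exact: smooth_linear. Qed.

Lemma derive_xcoord j v z : 'D_v (xcoord j) z = xcoord j v.
Proof. exact: derive_linear. Qed.

Lemma derive_ucoord v z : 'D_v ucoord z = ucoord v.
Proof. exact: derive_linear. Qed.

Lemma derive_pcoord j v z : 'D_v (pcoord j) z = pcoord j v.
Proof. exact: derive_linear. Qed.

Lemma derive_comp_fst (f : J0 R n -> R) v z :
  'D_v (fun z => f z.1) z = 'D_(v.1) f z.1.
Proof.
rewrite -[z.1 in RHS]addr0 -(@derive_affine _ _ _ fst)//.
by under [in RHS]eq_fun do rewrite addr0.
Qed.

Lemma smooth_comp_fst (f : J0 R n -> R) : smooth f -> smooth (fun z => f z.1).
Proof.
move=> sf; rewrite (_ : (fun z => _) = fun z => f (z.1 + 0)).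
  by apply: (@smooth_affine _ _ _ fst) => // z; exact: cvg_fst.
by apply/funext => z; rewrite addr0.
Qed.

Lemma smooth_base_xcoord j : smooth (fun y : J0 R n => y.1 0 j).
Proof.
apply: smooth_linear => [a y z|y]; first by rewrite /= !mxE.
apply: (@continuous_comp _ _ _ (fun y : J0 R n => y.1) (fun x => x 0 j)).
  exact: cvg_fst.
exact: coord_continuous.
Qed.

Lemma smooth_base_ucoord : smooth (fun y : J0 R n => y.2).
Proof. by apply: smooth_linear => // y; exact: cvg_snd. Qed.

Definition freeze_u (c : R) (f : J1 R n -> R) z : R := f (z.1.1, c, z.2).

Let slice z : J1 R n := (z.1.1, 0, z.2).

Let linear_slice : linear slice.
Proof.
move=> a y z; rewrite [RHS]surjective_pairing [X in (X, _)]surjective_pairing/=.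
by rewrite /slice/= scaler0 addr0.
Qed.

(** [slice] is the identity minus the projection onto the u-axis, so continuity reduces to that of
    [ucoord]. *)
Let continuous_slice : continuous slice.
Proof.
rewrite (_ : slice = fun z => z - ucoord z *: ((0, 1, 0) : J1 R n)).
  move=> z; apply: cvgB; first exact: cvg_id.
  by apply: cvgZr_tmp; exact: continuous_ucoord.
apply/funext => z; rewrite [RHS]surjective_pairing [X in _ = (X, _)]surjective_pairing/=.
by rewrite !scaler0 !subr0 [_ *: 1]mulr1 subrr.
Qed.

(** Freezing u is an affine substitution, which gives access to [smooth_affine] and
    [derive_affine]. *)
Let freeze_uE c f : freeze_u c f = fun z => f (slice z + (0, c, 0)).
Proof.
apply/funext => z; rewrite /freeze_u; congr (f _).
rewrite [RHS]surjective_pairing [X in _ = (X, _)]surjective_pairing/=.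
by rewrite add0r !addr0.
Qed.

Lemma smooth_freeze_u c f : smooth f -> smooth (freeze_u c f).
Proof. by rewrite freeze_uE; apply: smooth_affine. Qed.

Lemma derive_freeze_u c f v z :
  'D_v (freeze_u c f) z = freeze_u c (fun z => 'D_(v.1.1, 0, v.2) f z) z.
Proof. by rewrite freeze_uE derive_affine// [in RHS]freeze_uE. Qed.

End Coordinates.

(** * The contact brackets behind the generation argument *)

Section Brackets.
Context {R : realType} {n : nat}.
Implicit Types (f g : J1 R n -> R) (z : J1 R n) (i j : 'I_n).

Lemma dx_xcoord i j z : dx i (xcoord j) z = (i == j)%:R.
Proof. by rewrite /dx derive_xcoord /xcoord/= mxE eqxx/= eq_sym. Qed.

Lemma dx_pcoord i j z : dx i (pcoord j) z = 0.
Proof. by rewrite /dx derive_pcoord /pcoord/= mxE. Qed.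

Lemma dp_xcoord i j z : dp i (xcoord j) z = 0.
Proof. by rewrite /dp derive_xcoord /xcoord/= mxE. Qed.

Lemma dp_pcoord i j z : dp i (pcoord j) z = (i == j)%:R.
Proof. by rewrite /dp derive_pcoord /pcoord/= mxE eqxx/= eq_sym. Qed.

Lemma du_xcoord j z : du (xcoord j) z = 0.
Proof. by rewrite /du derive_xcoord /xcoord/= mxE. Qed.

Lemma dxM i f g z : smooth f -> smooth g ->
  dx i (fun z => f z * g z) z = dx i f z * g z + f z * dx i g z.
Proof. exact: derive_mul. Qed.

Lemma dpM i f g z : smooth f -> smooth g ->
  dp i (fun z => f z * g z) z = dp i f z * g z + f z * dp i g z.
Proof. exact: derive_mul. Qed.

Lemma duM f g z : smooth f -> smooth g ->
  du (fun z => f z * g z) z = du f z * g z + f z * du g z.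
Proof. exact: derive_mul. Qed.

Lemma dp_comp_fst i (f : J0 R n -> R) z : dp i (fun z => f z.1) z = 0.
Proof. by rewrite /dp derive_comp_fst derive0. Qed.

(** The operator H - p_i dH/dp_i differentiates in p only, so functions of x pass through it. *)
Lemma deg_defect_xcoordM j f z : smooth f ->
  deg_defect (fun z => xcoord j z * f z) z = xcoord j z * deg_defect f z.
Proof.
move=> sf; rewrite /deg_defect mulrBr mulr_sumr; congr (_ - _).
apply: eq_bigr => i _; rewrite dpM//; last exact: smooth_xcoord.
by rewrite dp_xcoord mul0r add0r mulrCA.
Qed.

(* Both brackets contain the same terms with a factor [x_j]; what is left is
   [{a p_j, x_j} K - a p_j {x_j, K}]. *)
Lemma bracket_pcoord_xcoord (a K : J1 R n -> R) j z :
  smooth a -> (forall i z, dp i a z = 0) -> scont K ->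
  contact_bracket (fun z => a z * pcoord j z) (fun z => xcoord j z * K z) z -
  contact_bracket (fun z => xcoord j z * (a z * pcoord j z)) K z =
  a z * (K z + pcoord j z * dp j K z).
Proof.
move=> sa dpa [sK duK].
have sx := @smooth_xcoord R n j; have sp := @smooth_pcoord R n j.
have sap := smooth_mul sa sp.
rewrite /contact_bracket !deg_defect_xcoordM// !(duM _ sx)// duK.
rewrite du_xcoord !(mul0r, mulr0, add0r, subr0).
have cancel (p q d x k : R) : p + d * (x * k) - (q + x * d * k) = p - q by ring.
rewrite cancel.
rewrite /poisson -sumrB (bigD1 j)//= big1 ?addr0 => [|i ij].
  rewrite !(dpM, dxM)// dpa dp_pcoord dp_xcoord dx_xcoord dx_pcoord eqxx mulr1n.
  by ring.
rewrite !(dpM, dxM)// dpa dp_pcoord dp_xcoord dx_xcoord dx_pcoord (negPf ij) mulr0n.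
by ring.
Qed.

(** A function of u alone has no x- or p-derivatives, so the Poisson part vanishes; strictness of
    [K] removes the last term. *)
Lemma bracket_ucoordX m (K : J1 R n -> R) z : scont K ->
  contact_bracket (fun z => ucoord z ^+ m.+1) K z =
  m.+1%:R * ucoord z ^+ m * deg_defect K z.
Proof.
move=> [sK duK]; have su := @smooth_ucoord R n.
rewrite /contact_bracket duK mul0r subr0.
rewrite /poisson big1 => [|i _].
  rewrite add0r /du derive_exp// derive_ucoord /ucoord/=.
  by rewrite mulr1.
rewrite /dp /dx !derive_exp// !derive_ucoord /ucoord/=.
by rewrite !mulr0 !mul0r subr0.
Qed.

End Brackets.

(** * Hamiltonians forced into every Lie subalgebra that contains the generators *)

Section LieSubalgebra.
Context {R : realType} {n : nat}.
Variable g : set (J1 R n -> R).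
Hypothesis lie_g : lie_subalgebra g.
Hypothesis gens_g : scont `|` pdiff `<=` g.

Let g0 : g (fun=> 0). Proof. by case: lie_g. Qed.

Let gZD (c : R) H K : g H -> g K -> g (fun z => c * H z + K z).
Proof. by case: lie_g => _ _ + _; apply. Qed.

Let gZ (c : R) H : g H -> g (fun z => c * H z).
Proof.
by move=> /(gZD c) /(_ g0); under eq_fun do rewrite addr0.
Qed.

Let gD H K : g H -> g K -> g (fun z => H z + K z).
Proof. by move=> /(gZD 1) /[apply]; under eq_fun do rewrite mul1r. Qed.

Let gB H K : g H -> g K -> g (fun z => H z - K z).
Proof.
move=> gH gK; rewrite (_ : (fun z => _) = fun z => -1 * K z + H z); first exact: gZD.
by apply/funext => z; rewrite mulN1r addrC.
Qed.

Let gsum (I : Type) (r : seq I) (P : pred I) (F : I -> J1 R n -> R) :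
  (forall i, P i -> g (F i)) -> g (fun z => \sum_(i <- r | P i) F i z).
Proof.
move=> gF; elim: r => [|i r IH].
  by under eq_fun do rewrite big_nil.
under eq_fun do rewrite big_cons.
by case Pi: (P i) => //; apply: gD => //; apply: gF.
Qed.

Let gbracket H K : g H -> g K -> g (contact_bracket H K).
Proof. by case: lie_g => _ _ _; apply. Qed.

Let pdiff_pcoord (a : J0 R n -> R) j : smooth a ->
  pdiff (fun z => a z.1 * pcoord j z).
Proof.
move=> sa; exists (fun=> 0), (fun i z => (i == j)%:R * a z); split=> [|i|z].
- exact: smooth_cst.
- exact: smooth_scale.
rewrite add0r (bigD1 j)//= eqxx mul1r big1 ?addr0// => i /negPf->.
by rewrite !mul0r.
Qed.

Lemma lie_mul_pcoord_derivative (a : J0 R n -> R) K j : smooth a -> scont K ->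
  g (fun z => a z.1 * (K z + pcoord j z * dp j K z)).
Proof.
move=> sa scK; have [sK duK] := scK.
rewrite (_ : (fun z => _) = fun z =>
    contact_bracket (fun z => a z.1 * pcoord j z) (fun z => xcoord j z * K z) z -
    contact_bracket (fun z => xcoord j z * (a z.1 * pcoord j z)) K z); last first.
  apply/funext => z; rewrite (@bracket_pcoord_xcoord _ _ (fun z => a z.1))//.
    exact: smooth_comp_fst.
  by move=> i y; rewrite dp_comp_fst.
(* Of the four entries, a p_j and x_j a p_j are affine in p, hence prolonged, while x_j K and K do
   not depend on u, hence are strict. *)
apply: gB; apply: gbracket; apply: gens_g.
- by right; apply: pdiff_pcoord.
- left; split; first exact/smooth_mul/sK/smooth_xcoord.
  by move=> z; rewrite duM ?duK ?du_xcoord ?mul0r ?mulr0 ?addr0//; exact: smooth_xcoord.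
- right; rewrite (_ : (fun z => _) = fun z => xcoord j z * a z.1 * pcoord j z).
    apply: (@pdiff_pcoord (fun y => y.1 0 j * a y)).
    exact/smooth_mul/sa/smooth_base_xcoord.
  by apply/funext => z; rewrite mulrA.
- by left.
Qed.

(** Summing over all j produces the Euler sum of p_j dK/dp_j, which the bracket with u^(m+1)
    supplies with the opposite sign. The cancellation lets [K] be an arbitrary strict Hamiltonian
    rather than a monomial. *)
Lemma lie_ucoordX m K : scont K -> g (fun z => ucoord z ^+ m * K z).
Proof.
move=> scK.
pose T z := \sum_j ucoord z ^+ m * (K z + pcoord j z * dp j K z).
have gT : g T.
  apply: gsum => j _; apply: (@lie_mul_pcoord_derivative (fun y => y.2 ^+ m)) => //.
  exact/smooth_exp/smooth_base_ucoord.
have gu : g (contact_bracket (fun z => ucoord z ^+ m.+1) K).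
  apply: gbracket; apply: gens_g; [right|by left].
  exists (fun y => y.2 ^+ m.+1), (fun _ => fun=> 0); split.
  - exact/smooth_exp/smooth_base_ucoord.
  - by move=> i; exact: smooth_cst.
  - by move=> z; rewrite big1 ?addr0// => i _; rewrite mul0r.
rewrite (_ : (fun z => _) = fun z => n.+1%:R^-1 *
    (m.+1%:R^-1 * contact_bracket (fun z => ucoord z ^+ m.+1) K z + T z)).
  by apply/gZ/gZD.
apply/funext => z; rewrite bracket_ucoordX// /T /deg_defect -mulr_sumr big_split/=.
rewrite sumr_const card_ord; set S := \sum_j _.
have -> : m.+1%:R^-1 * (m.+1%:R * ucoord z ^+ m * (K z - S)) =
    ucoord z ^+ m * (K z - S) by rewrite -mulrA mulKf ?pnatr_eq0.
rewrite -mulrDr addrA -addrA [X in _ * (_ * X)]addrACA.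
by rewrite addNr addr0 -mulrS -[K z *+ _]mulr_natl [in RHS]mulrCA mulKf ?pnatr_eq0.
Qed.

Lemma lie_monomial (f : J0 R n -> R) (a : 'I_n -> nat) : smooth f ->
  g (fun z => f z.1 * \prod_(i < n) z.2 0 i ^+ a i).
Proof.
(* For n = 0 there is no index j to bracket with; the empty product is 1 and f itself is
   prolonged. *)
move=> sf; case: (pickP (fun _ : 'I_n => true)) => [j _|no_index]; last first.
  apply: gens_g; right; exists f, (fun _ => fun=> 0); split=> // [i|z].
    exact: smooth_cst.
  by rewrite big1 => [|i]; [rewrite mulr1 big1 ?addr0// => i|]; have := no_index i.
pose F i (z : J1 R n) := pcoord i z ^+ a i.
have sF i : smooth (F i) by apply/smooth_exp/smooth_pcoord.
have dF i v z : pcoord i v = 0 -> 'D_v (F i) z = 0.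
  move=> vi; rewrite /F; case: (a i) => [|m].
    by under [X in 'D__ X _]eq_fun do rewrite expr0; rewrite derive_cst.
  by rewrite derive_exp ?derive_pcoord ?vi ?mulr0//; exact: smooth_pcoord.
pose K z := \prod_(i < n) F i z.
have scK : scont K.
  split; first exact: smooth_prod.
  move=> z; apply: derive_prod_eq0 => // i _ y; apply: dF.
  by rewrite /pcoord/= mxE.
(* Euler's identity in the variable p_j: K + p_j dK/dp_j is (a_j + 1) K, and a_j + 1 is
   invertible. *)
have pdpK z : pcoord j z * dp j K z = (a j)%:R * K z.
  rewrite /K; under [X in dp _ X]eq_fun do rewrite (bigD1 j)//=.
  rewrite dpM//; last exact: smooth_prod.
  rewrite [X in _ + _ * X]derive_prod_eq0//; last first.
    by move=> i ij y; apply: dF; rewrite /pcoord/= mxE eqxx/= (negPf ij).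
  rewrite mulr0 addr0 [in RHS](bigD1 j)//= !mulrA; congr (_ * _).
  rewrite /dp /F; case: (a j) => [|m].
    under [X in 'D__ X _]eq_fun do rewrite expr0.
    by rewrite derive_cst mulr0 mul0r.
  rewrite derive_exp; last exact: smooth_pcoord.
  by rewrite -/(dp j (pcoord j) z) dp_pcoord eqxx mulr1 exprS mulrCA.
rewrite (_ : (fun z => _) = fun z =>
    (a j).+1%:R^-1 * (f z.1 * (K z + pcoord j z * dp j K z))).
  exact/gZ/lie_mul_pcoord_derivative.
apply/funext => z; rewrite pdpK -[X in _ * (_ * (X + _))]mul1r -mulrDl nat1r.
by rewrite [in RHS]mulrCA mulKf ?pnatr_eq0.
Qed.

Lemma lie_poly_p k : poly_p k `<=` g.
Proof.
move=> H [f [sf HE]]; rewrite (_ : H = fun z =>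
    \sum_(a : {ffun 'I_n -> 'I_k.+1} | (\sum_i a i <= k)%N)
      f a z.1 * \prod_(i < n) z.2 0 i ^+ a i); last exact/funext.
by apply: gsum => a _; apply: lie_monomial.
Qed.

End LieSubalgebra.

(** * Bernstein means and their variance estimate *)

Section Bernstein.
Context {R : realType}.
Implicit Types (t x a c e C : R) (phi psi : nat -> R) (m k : nat).

(* De Casteljau's recursion: the mean of [phi] under the binomial law with
   parameters [m] and [t]. *)
Fixpoint bernstein m t phi : R :=
  if m is m'.+1 then
    (1 - t) * bernstein m' t phi + t * bernstein m' t (fun k => phi k.+1)
  else phi 0%N.

(** For t in [0, 1] every step of the recursion is a convex combination. *)
Lemma le_bernstein m t phi psi : 0 <= t <= 1 ->
  (forall k, (k <= m)%N -> phi k <= psi k) ->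
  bernstein m t phi <= bernstein m t psi.
Proof.
move=> /andP[t0 t1]; elim: m phi psi => [|m IH] phi psi /=.
  move=> le_phi_psi; exact: le_phi_psi.
move=> le_phi_psi; apply: lerD; apply: ler_wpM2l; rewrite ?subr_ge0//; apply: IH => k km;
  apply: le_phi_psi => //; exact: leqW.
Qed.

(** The binomial law has mean m t and variance m t (1 - t). The centre x is arbitrary because the
    shift k -> k + 1 in the recursion replaces x by x - 1. *)
Lemma bernstein_quadratic m t a C x :
  bernstein m t (fun k => a + C * (k%:R - x) ^+ 2) =
  a + C * ((m%:R * t - x) ^+ 2 + m%:R * (t * (1 - t))).
Proof.
elim: m x => [|m IH] x /=; first by rewrite !mul0r addr0.
rewrite IH; under eq_fun do rewrite -natr1 -addrA -opprB.
by rewrite IH -natr1; ring.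
Qed.

(** A Chebyshev-type bound: phi lies between two quadratics centred at the mean m t, and their
    Bernstein means are explicit. *)
Lemma bernstein_dist m t phi c e C : 0 <= t <= 1 ->
  (forall k, (k <= m)%N -> `|c - phi k| <= e + C * (k%:R - m%:R * t) ^+ 2) ->
  `|c - bernstein m t phi| <= e + C * (m%:R * (t * (1 - t))).
Proof.
move=> t01 H.
have centered a D : bernstein m t (fun k => a + D * (k%:R - m%:R * t) ^+ 2) =
    a + D * (m%:R * (t * (1 - t))).
  by rewrite bernstein_quadratic subrr expr0n add0r.
have Hu : bernstein m t phi <= (c + e) + C * (m%:R * (t * (1 - t))).
  rewrite -centered; apply: le_bernstein => // k /H.
  by rewrite ler_norml => /andP[? ?]; lra.
have Hl : (c - e) + - C * (m%:R * (t * (1 - t))) <= bernstein m t phi.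
  rewrite -centered; apply: le_bernstein => // k /H.
  by rewrite ler_norml => /andP[? ?]; lra.
by rewrite ler_norml; apply/andP; split; lra.
Qed.

End Bernstein.

(** * Compact boxes and uniform continuity on them *)

Section Box.
Context {R : realType} {n : nat}.

(** The product form lets u be replaced by any value in [- M, M] without leaving the box, as needed
    for Bernstein nodes and for segments to the slice u = 0. *)
Definition box (M : R) : set (J1 R n) :=
  ([set x | `|x| <= M] `*` [set u | `|u| <= M]) `*` [set p | `|p| <= M].

Lemma box_compact M : compact (box M).
Proof.
have ball_compact k : compact [set x : 'rV[R]_k | `|x| <= M].
  apply: bounded_closed_compact.
    by exists M; split; [exact: num_real|move=> y My x /= /le_trans; apply; exact: ltW].
  apply: (@closed_comp _ _ (fun x : 'rV[R]_k => `|x|) [set y | y <= M]).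
    by move=> x _; exact: norm_continuous.
  exact: closed_le.
apply: compact_setX; last exact: ball_compact.
apply: compact_setX; first exact: ball_compact.
rewrite (_ : [set u | _] = `[- M, M]%classic); first exact: segment_compact.
by apply/seteqP; split => u /=; rewrite in_itv/= ler_norml.
Qed.

(** Heine-Cantor through the covering form of compactness; only [z] is confined to the box. *)
Lemma box_unif_continuous (psi : J1 R n -> R) M (e : R) : continuous psi -> 0 < e ->
  exists2 d : R, 0 < d & forall z w, box M z -> ball z d w -> `|psi z - psi w| < e.
Proof.
move=> cpsi e0.
have near_d : \forall d \near 0^'+, box M `<=`
    [set z | forall w, ball z d w -> `|psi z - psi w| < e].
  have /compact_near_coveringP := @box_compact M.
  apply=> z _.
  have e20 : 0 < e / 2 by rewrite divr_gt0.
  have [d /= d0 near_z] : nbhs_ball z [set y | `|psi z - psi y| < e / 2].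
    by apply/nbhs_ballP; move/cvgrPdist_lt: (cpsi z); apply.
  have d20 : 0 < d / 2 by rewrite divr_gt0.
  (* If y is within d / 2 of z and the radius r is below d / 2, then both y and every w within r of
     y are within d of z. *)
  exists (ball z (d / 2), [set r | r < d / 2]).
    by split; [exact: nbhsx_ballx|exact: nbhs_right_lt].
  case=> y r /= [zy rd] w yw.
  have zw : ball z d w.
    by rewrite [d]splitr; apply: ball_triangle zy _; apply: le_ball yw; exact: ltW.
  have zy' : ball z d y by apply: le_ball zy; rewrite ler_pdivrMr// ler_pMr// ler1n.
  have /= := near_z _ zw; have /= := near_z _ zy'.
  rewrite !ltr_norml => /andP[? ?] /andP[? ?]; apply/andP; split; lra.
have [d [box_d d0]] := filter_ex (filterI near_d (nbhs_right_gt (0 : R))).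
by exists d => // z w Mz; apply: box_d.
Qed.

End Box.

(** * Polynomials in u with strict coefficients, and Bernstein approximants among them *)

Section SeparatedApproximation.
Context {R : realType} {n : nat}.
Implicit Types (F G H K P Q : J1 R n -> R) (z : J1 R n) (m k : nat).

(* Polynomials in u with coefficients depending on (x, p) only. *)
Inductive upoly : (J1 R n -> R) -> Prop :=
| upoly_monomial m K : scont K -> upoly (fun z => ucoord z ^+ m * K z)
| upoly_add F G : upoly F -> upoly G -> upoly (fun z => F z + G z).

Lemma upoly_scont K : scont K -> upoly K.
Proof.
move=> scK; rewrite (_ : K = fun z => ucoord z ^+ 0 * K z).
  exact: upoly_monomial.
by apply/funext => z; rewrite expr0 mul1r.
Qed.

Lemma scont_scale (c : R) K : scont K -> scont (fun z => c * K z).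
Proof.
move=> [sK duK]; split; first exact: smooth_scale.
by move=> z; rewrite /du derive_scale// -/(du K z) duK mulr0.
Qed.

Lemma upoly_scale (c : R) F : upoly F -> upoly (fun z => c * F z).
Proof.
elim=> [m K scK|{}F G _ IF _ IG].
  by under eq_fun do rewrite mulrCA; exact/upoly_monomial/scont_scale.
by under eq_fun do rewrite mulrDr; exact: upoly_add.
Qed.

(** De Casteljau's recursion multiplies by t and 1 - t, both affine in u. *)
Lemma upoly_affine (a b : R) F : upoly F -> upoly (fun z => (a * ucoord z + b) * F z).
Proof.
move=> uF; under eq_fun do rewrite mulrDl -mulrA.
apply: upoly_add; apply: upoly_scale => //.
elim: uF => [m K scK|{}F G _ IF _ IG].
  by under eq_fun do rewrite mulrA -exprS; exact: upoly_monomial.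
by under eq_fun do rewrite mulrDr; exact: upoly_add.
Qed.

Lemma upoly_smooth F : upoly F -> smooth F.
Proof.
elim=> [m K [sK _]|{}F G _ sF _ sG]; last exact: smooth_add.
by apply: smooth_mul sK; exact/smooth_exp/smooth_ucoord.
Qed.

Lemma upoly_lie (g : set (J1 R n -> R)) : lie_subalgebra g ->
  scont `|` pdiff `<=` g -> upoly `<=` g.
Proof.
move=> lie_g gens_g F; elim=> [m K|{}F G _ gF _ gG]; first exact: lie_ucoordX.
have [_ _ + _] := lie_g => /(_ 1 _ _ gF gG).
by under eq_fun do rewrite mul1r.
Qed.

(** Termwise integration in u. Vanishing on u = 0 leaves the constant of integration free to be
    chosen as the restriction of the target there. *)
Lemma upoly_primitive Q : upoly Q -> exists P,
  [/\ upoly P, forall z, du P z = Q z & forall z, freeze_u 0 P z = 0].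
Proof.
elim=> [m K scK|F G _ [P1 [u1 d1 f1]] _ [P2 [u2 d2 f2]]].
  have [sK duK] := scK.
  exists (fun z => ucoord z ^+ m.+1 * (m.+1%:R^-1 * K z)); split=> [|z|z].
  - exact/upoly_monomial/scont_scale.
  - have su := @smooth_ucoord R n.
    rewrite duM; [|exact: smooth_exp|exact: smooth_scale].
    have [_ ->] := scont_scale m.+1%:R^-1 scK; rewrite mulr0 addr0.
    rewrite /du derive_exp// derive_ucoord /ucoord/= mulr1.
    by rewrite [_ * _ ^+ m]mulrC mulrA -[_ * m.+1%:R * _]mulrA mulfV ?pnatr_eq0// mulr1.
  - by rewrite /freeze_u /ucoord/= expr0n mul0r.
exists (fun z => P1 z + P2 z); split=> [|z|z]; first exact: upoly_add.
  by rewrite /du derive_add -?/(du _ z) ?d1 ?d2//; exact: upoly_smooth.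
by move: (f1 z) (f2 z); rewrite /freeze_u => -> ->; rewrite addr0.
Qed.

Lemma freeze_u_scont (c : R) H : smooth H -> scont (freeze_u c H).
Proof.
move=> sH; split; first exact: smooth_freeze_u.
by move=> z; rewrite /du derive_freeze_u /freeze_u derive0.
Qed.

Lemma upoly_bernstein m (a b : R) (psi : nat -> J1 R n -> R) :
  (forall k, scont (psi k)) ->
  upoly (fun z => bernstein m (a * ucoord z + b) (fun k => psi k z)).
Proof.
elim: m psi => [|m IH] psi scpsi /=; first exact: upoly_scont.
apply: upoly_add; last exact/upoly_affine/IH.
under eq_fun do rewrite opprD addrCA -mulNr.
exact/upoly_affine/IH.
Qed.

(* The Bernstein polynomial in u for the interval [- M, M], whose affine
   coordinate (u + M) / (2 M) is written here as an explicit affine function of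
   u; for [m = 0] the only node is [- M]. *)
Definition bernstein_u (M : R) m H z : R :=
  bernstein m ((2 * M)^-1 * ucoord z + 2^-1)
    (fun k => freeze_u (- M + (2 * M) * (k%:R / m%:R)) H z).

Lemma upoly_bernstein_u M m H : smooth H -> upoly (bernstein_u M m H).
Proof. by move=> sH; apply: upoly_bernstein => k; apply: freeze_u_scont. Qed.

(** Along a direction without u-component the weights t and 1 - t are constant, so only the
    coefficients are differentiated. *)
Lemma derive_bernstein m (a b : R) (psi : nat -> J1 R n -> R) (v : J1 R n) z :
  ucoord v = 0 -> (forall k, scont (psi k)) ->
  'D_v (fun z => bernstein m (a * ucoord z + b) (fun k => psi k z)) z =
  bernstein m (a * ucoord z + b) (fun k => 'D_v (psi k) z).
Proof.
move=> v0; elim: m psi => [//|m IH] psi scpsi /=.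
have su := @smooth_ucoord R n.
have st : smooth (fun z => a * ucoord z + b).
  exact/smooth_add/smooth_cst/smooth_scale.
have st' : smooth (fun z => 1 - (a * ucoord z + b)) by exact/smooth_sub/st/smooth_cst.
have dt : 'D_v (fun z => a * ucoord z + b) z = 0.
  rewrite derive_add; [|exact: smooth_scale|exact: smooth_cst].
  by rewrite derive_scale// derive_ucoord v0 mulr0 derive_cst addr0.
have dt' : 'D_v (fun z => 1 - (a * ucoord z + b)) z = 0.
  by rewrite derive_sub//; [rewrite derive_cst dt subrr|exact: smooth_cst].
have sb (phi : nat -> J1 R n -> R) : (forall k, scont (phi k)) ->
    smooth (fun z => bernstein m (a * ucoord z + b) (fun k => phi k z)).
  by move=> scphi; exact/upoly_smooth/upoly_bernstein.
have sb0 := sb psi scpsi; have sb1 := sb (fun k => psi k.+1) (fun k => scpsi k.+1).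
rewrite derive_add; [|exact: smooth_mul|exact: smooth_mul].
rewrite !derive_mul//.
by rewrite dt dt' !mul0r !add0r IH// (IH (fun k => psi k.+1)).
Qed.

Lemma derive_freeze_u_horizontal (c : R) H (v : J1 R n) z : ucoord v = 0 ->
  'D_v (freeze_u c H) z = freeze_u c (fun z => 'D_v H z) z.
Proof.
move=> v0; rewrite derive_freeze_u (_ : (v.1.1, 0, v.2) = v)// -v0.
by case: v {v0} => -[].
Qed.

Lemma derive_bernstein_u M m H (v : J1 R n) z : ucoord v = 0 -> smooth H ->
  'D_v (bernstein_u M m H) z = bernstein_u M m (fun z => 'D_v H z) z.
Proof.
move=> v0 sH.
pose psi k := freeze_u (- M + (2 * M) * (k%:R / m%:R)) H.
have scpsi k : scont (psi k) by exact: freeze_u_scont.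
have Dpsi : (fun k => 'D_v (psi k) z) =
    fun k => freeze_u (- M + (2 * M) * (k%:R / m%:R)) (fun z => 'D_v H z) z.
  by apply/funext => k; exact: derive_freeze_u_horizontal.
have := derive_bernstein m (2 * M)^-1 2^-1 z v0 scpsi; rewrite Dpsi; exact.
Qed.

Lemma iter_derive_bernstein_u M m H vs : smooth H ->
  (forall v, v \in vs -> ucoord v = 0) ->
  iter_derive vs (bernstein_u M m H) = bernstein_u M m (iter_derive vs H).
Proof.
move=> sH; elim: vs => //= v vs IH vs0.
rewrite IH => [|w wvs]; last by apply: vs0; rewrite inE wvs orbT.
apply/funext => z; rewrite derive_bernstein_u//; last exact: smooth_iter_derive.
by apply: vs0; rewrite inE eqxx.
Qed.

Lemma iter_derive_freeze_u c H vs : 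
  (forall v, v \in vs -> ucoord v = 0) ->
  iter_derive vs (freeze_u c H) = freeze_u c (iter_derive vs H).
Proof.
elim: vs => //= v vs IH vs0.
rewrite IH => [|w wvs]; last by apply: vs0; rewrite inE wvs orbT.
apply/funext => z; rewrite derive_freeze_u_horizontal//.
by apply: vs0; rewrite inE eqxx.
Qed.

End SeparatedApproximation.

(** * Approximation of all frame derivatives up to a given order on a box *)

Section UniformApproximation.
Context {R : realType} {n : nat}.
Implicit Types (F G H K P Q : J1 R n -> R) (z : J1 R n) (M e : R) (m s r : nat).

(** Bernstein's argument: nodes within d of u contribute at most e / 2 by uniform continuity, and
    the remaining nodes are controlled by the variance. *)
Lemma bernstein_u_cvg M e F : 0 < M -> 0 < e -> continuous F ->
  \forall m \near \oo, forall z, box M z -> `|F z - bernstein_u M m F z| <= e.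
Proof.
move=> M0 e0 cF.
have e20 : 0 < e / 2 by rewrite divr_gt0.
have [d d0 dF] := box_unif_continuous M cF e20.
have [B B0 BF] : exists2 B, 0 < B & forall z, box M z -> `|F z| <= B.
  have cFM : {within box M, continuous F} by exact: continuous_subspaceT.
  have /compact_bounded[B [_ BF]] := continuous_compact cFM (@box_compact R n M).
  (* Boundedness provides a bound for each constant strictly above [B]; this one is also
     positive. *)
  exists (`|B| + 1); first by rewrite ltr_wpDl.
  move=> z Mz; apply: BF; last by exists z.
  by rewrite (le_lt_trans (ler_norm B))// ltrDl.
(* At a far node w the difference is at most 2 B <= 2 B ((w - u) / d)^2. Since w - u = (2 M / m) (k
   - m t), this equals C / m^2 times (k - m t)^2. *)
pose C := 2 * B * (2 * M / d) ^+ 2.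
have C0 : 0 <= C by rewrite mulr_ge0 ?sqr_ge0// mulr_ge0// ltW.
near=> m => z Mz.
have m0 : 0 < m%:R :> R by rewrite ltr0n; near: m; exact: nbhs_infty_gt.
have Cm : C / m%:R <= e / 2.
  rewrite ler_pdivrMr// mulrC -ler_pdivrMr//.
  by near: m; exact: nbhs_infty_ger.
have [[zx zu] zp] := Mz.
pose t := (2 * M)^-1 * ucoord z + 2^-1.
have uE : ucoord z = - M + 2 * M * t.
  by rewrite /t; field; rewrite gt_eqF.
have t01 : 0 <= t <= 1.
  move: zu; rewrite /= -/(ucoord z) ler_norml uE => /andP[l u].
  have M20 : 0 < 2 * M by rewrite mulr_gt0.
  by apply/andP; split; rewrite -(ler_pM2l M20) ?mulr0 ?mulr1; lra.
have tt1 : t * (1 - t) <= 1.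
  by case/andP: t01 => ? ?; rewrite mulr_ile1// ?subr_ge0// gerBl.
apply: (le_trans (bernstein_dist (e := e / 2) (C := C / m%:R ^+ 2) t01 _)) => [k km|].
  set w := - M + _; rewrite -/t.
  have kE : w - ucoord z = 2 * M / m%:R * (k%:R - m%:R * t).
    by rewrite uE /w; field; rewrite gt_eqF.
  have Mw : `|w| <= M.
    have k01 : 0 <= (k%:R / m%:R : R) <= 1.
      by rewrite divr_ge0// ler_pdivrMr// mul1r ler_nat.
    rewrite /w ler_norml; case/andP: k01 => ? ?; apply/andP; split; nra.
  have [near_w|far_w] := ltP `|w - ucoord z| d.
    apply: (@le_trans _ _ (e / 2)); last first.
      by rewrite lerDl mulr_ge0 ?sqr_ge0// divr_ge0 ?sqr_ge0.
    apply/ltW/dF => //; split => /=; last exact: ballxx.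
    by split => /=; [exact: ballxx|rewrite -ball_normE/= distrC].
  apply: (@le_trans _ _ (2 * B)).
    apply: (le_trans (ler_normB _ _)); rewrite mulr2n mulrDl mul1r lerD ?BF//.
  apply: (@le_trans _ _ (C / m%:R ^+ 2 * (k%:R - m%:R * t) ^+ 2)); last first.
    by rewrite lerDr ltW.
  rewrite (_ : C / _ * _ = 2 * B * ((w - ucoord z) / d) ^+ 2); last first.
    by rewrite kE /C; field; rewrite !gt_eqF.
  rewrite ler_pMr ?mulr_gt0// -real_normK ?num_real// expr_ge1//.
  by rewrite normrM normfV (gtr0_norm d0) ler_pdivlMr// mul1r.
(* The variance m t (1 - t) is at most m, so the far nodes contribute at most C / m. *)
rewrite [leRHS]splitr lerD2l; apply: le_trans Cm.
rewrite (_ : C / _ * _ = C / m%:R * (t * (1 - t))); last first.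
  by field; rewrite gt_eqF.
by rewrite ler_piMr// divr_ge0// ltW.
Unshelve. all: by end_near.
Qed.

(** The u-direction is singled out as [None], so that [count_mem None] counts u-derivatives. *)
Definition frame (i : option ('I_n + 'I_n)) : J1 R n :=
  match i with
  | None => (0, 1, 0)
  | Some (inl i) => (delta_mx 0 i, 0, 0)
  | Some (inr i) => (0, 0, delta_mx 0 i)
  end.

Lemma horizontal_frame es : None \notin es ->
  forall v, v \in map frame es -> ucoord v = 0.
Proof.
move=> Nes v /mapP[[[i|i]|] + ->] //.
by rewrite (negPf Nes).
Qed.

(** Horizontal derivatives commute with [bernstein_u], so uniform convergence for each derivative of
    H suffices. A single m serves all lists because there are finitely many of length at most s. *)
Lemma horizontal_approx M e s H : 0 < M -> 0 < e -> smooth H ->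
  \forall m \near \oo, forall es, (size es <= s)%N -> None \notin es ->
    forall z, box M z ->
    `|iter_derive (map frame es) (fun z => H z - bernstein_u M m H z) z| <= e.
Proof.
move=> M0 e0 sH.
suff near_m : \forall m \near \oo, forall es, (size es <= s)%N -> None \notin es ->
    forall z, box M z -> `|iter_derive (map frame es) H z -
      bernstein_u M m (iter_derive (map frame es) H) z| <= e.
  apply: filterS near_m => m Hm es ess Nes z Mz.
  rewrite iter_derive_sub//; last exact/upoly_smooth/upoly_bernstein_u.
  rewrite iter_derive_bernstein_u//; first exact: Hm.
  exact: horizontal_frame.
elim: s H sH => [|s IH] H sH.
  apply: filterS (bernstein_u_cvg M0 e0 (smooth_continuous sH)) => m Hm es.
  by rewrite leqn0 size_eq0 => /eqP -> _ /=.
have near0 := bernstein_u_cvg M0 e0 (smooth_continuous sH).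
pose DH i z := 'D_(frame i) H z.
have nearS : \forall m \near \oo, forall i es, (size es <= s)%N -> None \notin es ->
    forall z, box M z -> `|iter_derive (map frame es) (DH i) z -
      bernstein_u M m (iter_derive (map frame es) (DH i)) z| <= e.
  by apply: filter_forall => i; apply: IH; exact: smooth_derive.
(* The last entry is the derivative applied first; peeling it off replaces H by one of its finitely
   many frame derivatives. *)
apply: filterS2 near0 nearS => m H0 HS; case/lastP => [_ _|es i]; first exact: H0.
rewrite size_rcons ltnS mem_rcons inE negb_or => ess /andP[_ Nes].
rewrite map_rcons -cats1 iter_derive_cat /=.
exact: HS.
Qed.

(** Induction on the number r of u-derivatives allowed: approximate dH/du with one fewer, then
    integrate in u. The order s stays fixed, since lists without u-derivatives are estimated through
    dH/du at full length. *)
Lemma separated_approx r s M e H : 0 < M -> 0 < e -> smooth H ->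
  exists2 K, upoly K & forall es, (size es <= s)%N -> (count_mem None es <= r)%N ->
    forall z, box M z -> `|iter_derive (map frame es) (fun z => H z - K z) z| <= e.
Proof.
move=> M0; elim: r s e H => [|r IH] s e H e0 sH.
  have [m Hm] := filter_ex (horizontal_approx s M0 e0 sH).
  exists (bernstein_u M m H); first exact: upoly_bernstein_u.
  move=> es ess; rewrite leqn0 => /eqP Nes; apply: Hm => //.
  by apply/count_memPn.
(* Chosen so that both d <= e and d M <= e: the first serves lists containing a u-derivative, the
   second the integration over a u-segment of length at most M. *)
pose d := e / (M + 1).
have M10 : 0 < M + 1 by rewrite addr_gt0.
have d0 : 0 < d by rewrite divr_gt0.
have de : d <= e by rewrite ler_pdivrMr// ler_pMr// lerDr ltW.
have dMe : d * M <= e.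
  by rewrite mulrAC ler_pdivrMr// ler_pM2l// lerDl.
have sG : smooth (du H) by exact: smooth_derive.
have [Q uQ HQ] := IH s d (du H) d0 sG.
have [P [uP duP P0]] := upoly_primitive uQ.
have sP := upoly_smooth uP.
have sH0 := smooth_freeze_u 0 sH.
(* The added slice of H makes K agree with H exactly on u = 0. *)
pose K z := freeze_u 0 H z + P z.
have uK : upoly K by apply: upoly_add => //; exact/upoly_scont/freeze_u_scont.
have sK := upoly_smooth uK.
exists K => // es ess Nes z Mz.
pose F z := H z - K z.
have sF : smooth F by exact: smooth_sub.
have duF : (fun z => 'D_(frame None) F z) = fun z => du H z - Q z.
  apply/funext => y; rewrite /F derive_sub// derive_add// -!/(du _ _) duP.
  by have [_ ->] := freeze_u_scont 0 sH; rewrite add0r.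
rewrite -/F; have [Nin|Nnotin] := boolP (None \in es).
  (* One u-derivative is moved onto F, turning the error into dH/du - Q with one fewer u-derivative
     to take. *)
  case/splitPr: Nin ess Nes => es1 es2 ess Nes.
  rewrite map_cat/= iter_derive_mid// -map_cat duF.
  apply: (le_trans (HQ _ _ _ _ Mz)) => //.
    by apply: leq_trans ess; rewrite !size_cat/= addnS.
  by move: Nes; rewrite !count_cat/= add1n addnS ltnS.
pose W := iter_derive (map frame es) F.
have sW : smooth W by exact: smooth_iter_derive.
have W0 : W (z.1.1, 0, z.2) = 0.
  rewrite -[LHS]/(freeze_u 0 W z) -iter_derive_freeze_u; last exact: horizontal_frame.
  (* Writing the zero function as 0 * H lets [iter_derive_scale] evaluate all its derivatives. *)
  rewrite (_ : freeze_u 0 F = fun z => 0 * H z).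
    by rewrite iter_derive_scale// mul0r.
  apply/funext => y; rewrite mul0r /F /K /freeze_u/=.
  by have := P0 y; rewrite /freeze_u => ->; rewrite addr0 subrr.
have duW y : 'D_(frame None) W y = iter_derive (map frame es) (fun z => du H z - Q z) y.
  by rewrite iter_derive_derive// duF.
have [[zx zu] zp] := Mz.
have lineE (y : J1 R n) (t : R) : y + t *: frame None = (y.1.1, y.1.2 + t, y.2).
  rewrite [LHS]surjective_pairing [X in (X, _) = _]surjective_pairing/=.
  by rewrite !scaler0 !addr0 [_ *: 1]mulr1.
have duW_le (u : R) : `|u| <= M -> `|'D_(frame None) W (z.1.1, u, z.2)| <= d.
  by move=> uM; rewrite duW; apply: HQ => //; rewrite (count_memPn Nnotin).
rewrite -/(W z); have := zu; rewrite /= ler_norml => /andP[lu uu].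
(* [mean_value] moves only forwards: from the slice u = 0 up to z if u >= 0, and from z up to the
   slice otherwise. *)
have [u0|u0] := leP 0 z.1.2.
  have [t /andP[t0 tu]] := mean_value (frame None) (z.1.1, 0, z.2) sW u0.
  rewrite !lineE/= W0 subr0 !add0r (_ : (_, _, _) = z); last by case: (z) => -[].
  move=> ->; rewrite normrM (ger0_norm u0); apply: le_trans dMe.
  by rewrite ler_pM// duW_le// ger0_norm// (le_trans tu).
have Nu0 : 0 <= - z.1.2 by rewrite oppr_ge0 ltW.
have [t /andP[t0 tu]] := mean_value (frame None) z sW Nu0.
rewrite !lineE/= subrr W0 sub0r => WE.
rewrite -normrN WE normrM (ger0_norm Nu0); apply: le_trans dMe.
rewrite ler_pM// ?duW_le//; last by rewrite lerNl.
by rewrite ler_norml; apply/andP; split; lra.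
Qed.

End UniformApproximation.

(** * From frame derivatives to the C^r norm *)

Section FrameExpansion.
Context {R : realType} {n : nat}.
Implicit Types (F : J1 R n -> R) (v z : J1 R n).

Let coef (i : option ('I_n + 'I_n)) v : R :=
  match i with
  | None => v.1.2
  | Some (inl i) => v.1.1 0 i
  | Some (inr i) => v.2 0 i
  end.

Let indices : seq (option ('I_n + 'I_n)) :=
  None :: [seq Some (inl i) | i <- index_enum 'I_n] ++
          [seq Some (inr i) | i <- index_enum 'I_n].

Lemma frame_expansion v : v = \sum_(i <- indices) coef i v *: frame i.
Proof.
rewrite big_cons big_cat !big_map /=.
rewrite [RHS]surjective_pairing [X in _ = (X, _)]surjective_pairing/=.
rewrite !(linear_sum fst)/= !(linear_sum snd)/=.
case: v => -[x u] p /=; congr (_, _, _).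
- rewrite scaler0 add0r [X in _ + X]big1 ?addr0 => [|i _]; last exact: scaler0.
  exact: row_sum_delta.
- rewrite [_ *: 1]mulr1 !big1 ?addr0// => i _; exact: scaler0.
- rewrite scaler0 add0r [X in X + _]big1 ?add0r => [|i _]; last exact: scaler0.
  exact: row_sum_delta.
Qed.

Lemma norm_coord_le (x : 'rV[R]_n) i : `|x 0 i| <= `|x|.
Proof.
rewrite [leRHS]/Num.norm/= mx_normrE.
by apply/bigmax_geP; right => /=; exists (0, i).
Qed.

Lemma norm_coef_le i v : `|coef i v| <= `|v|.
Proof.
rewrite prod_normE le_max [`|v.1|]prod_normE le_max.
by case: i => [[i|i]|]; rewrite ?norm_coord_le ?lexx ?orbT.
Qed.

(** Expand every direction in the frame: by multilinearity, with coefficients of modulus at most 1,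
    each direction costs a factor 2n + 1, the length of [indices]. *)
Lemma iter_derive_frame_le (A : set (J1 R n)) (k : nat) (e : R) F : smooth F -> 0 <= e ->
  (forall es, size es = k ->
    forall z, A z -> `|iter_derive (map frame es) F z| <= e) ->
  forall vs, size vs = k -> (forall v, v \in vs -> `|v| <= 1) ->
    forall z, A z -> `|iter_derive vs F z| <= (size indices)%:R ^+ k * e.
Proof.
move=> sF e0 HF vs vsk vs1 z Az.
(* Generalised to lists whose initial part already consists of frame vectors; each step expands the
   first arbitrary direction and appends the frame vector to that part. *)
have general (ws : seq (J1 R n)) : (forall v, v \in ws -> `|v| <= 1) ->
    forall es, (size es + size ws)%N = k ->
    `|iter_derive (map frame es ++ ws) F z| <= (size indices)%:R ^+ size ws * e.
  elim: ws => [|w ws IH] ws1 es esk.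
    by rewrite cats0 expr0 mul1r; apply: HF => //; rewrite -esk addn0.
  have ws1' v : v \in ws -> `|v| <= 1 by move=> vws; apply: ws1; rewrite inE vws orbT.
  have sG : smooth (iter_derive ws F) by exact: smooth_iter_derive.
  rewrite iter_derive_cat/=.
  rewrite (_ : (fun z => _) = fun z =>
      \sum_(i <- indices) coef i w * 'D_(frame i) (iter_derive ws F) z); last first.
    by apply/funext => y; rewrite {1}(frame_expansion w) derive_sum_dir.
  rewrite iter_derive_sum => [|i]; last exact/smooth_scale/smooth_derive.
  apply: (le_trans (ler_norm_sum _ _ _)).
  apply: (@le_trans _ _ (\sum_(i <- indices) (size indices)%:R ^+ size ws * e)).
    apply: ler_sum => i _; rewrite iter_derive_scale; last exact: smooth_derive.
    rewrite normrM -[leRHS]mul1r ler_pM//.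
      by apply: (le_trans (norm_coef_le i w)); apply: ws1; rewrite inE eqxx.
    have := IH ws1' (rcons es i); rewrite map_rcons cat_rcons iter_derive_cat/=.
    by apply; rewrite size_rcons addSnnS.
  by rewrite big_const_seq count_predT iter_addr_0 -[leLHS]mulr_natl exprS mulrA.
by have := general vs vs1 [::]; rewrite vsk; apply.
Qed.

Lemma Cr_norm_le (r : nat) (A : set (J1 R n)) : exists2 C : R, 0 < C &
  forall F (e : R), smooth F -> 0 <= e ->
  (forall es, (size es <= r)%N ->
    forall z, A z -> `|iter_derive (map frame es) F z| <= e) ->
  (Cr_norm r A F <= (C * e)%:E)%E.
Proof.
have N1 : 1 <= (size indices)%:R :> R by rewrite ler1n.
(* This power dominates the constants of all orders k <= r because its base is at least 1. *)
exists ((size indices)%:R ^+ r) => [|F e sF e0 HF].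
  by rewrite exprn_gt0// (lt_le_trans ltr01).
apply: bigmax_le => [|k _].
  by rewrite lee_fin mulr_ge0// exprn_ge0// ler0n.
have kr : (k <= r)%N by rewrite -ltnS.
apply: ge_ereal_sup => _ [z Az <-]; apply: ge_ereal_sup => _ [vs vs1 <-].
rewrite lee_fin; apply: (@le_trans _ _ ((size indices)%:R ^+ k * e)).
  apply: (iter_derive_frame_le (A := A) sF e0) => //.
  - by move=> es esk; apply: HF; rewrite esk.
  - exact: size_tuple.
  - by move=> v /tnthP[i ->]; exact: vs1.
by rewrite ler_wpM2r// ler_weXn2l.
Qed.

End FrameExpansion.

(** * Polynomial Hamiltonians in the generated Lie algebra, and its density *)

Theorem proposition3p1 (R : realType) (n : nat) :
  (forall k : nat, @poly_p R n k `<=` lie_scont_pdiff) /\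
  (forall (r : nat) (U : set (J1 R n)) (H : J1 R n -> R) (eps : R),
     compact U -> smooth H -> 0 < eps ->
     exists2 K : J1 R n -> R, lie_scont_pdiff K &
       (Cr_norm r U (fun z : J1 R n => H z - K z)%R < eps%:E)%E).
Proof.
(* Membership in [smallest] means membership in every Lie subalgebra [g] containing the
   generators. *)
split=> [k H pH g [lie_g gens_g]|r U H eps cU sH eps0].
  exact: (lie_poly_p lie_g gens_g pH).
have [M M0 UM] : exists2 M, 0 < M & U `<=` box M.
  have [B [_ UB]] := compact_bounded cU.
  exists (`|B| + 1) => [|z Uz]; first by rewrite ltr_wpDl.
  have : `|z| <= `|B| + 1.
    by apply: UB => //; rewrite (le_lt_trans (ler_norm B))// ltrDl.
  by rewrite prod_normE ge_max [`|z.1|]prod_normE ge_max -andbA => /and3P[].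
have [C C0 CU] := Cr_norm_le r U.
(* [CU] gives only a non-strict bound C e; the factor 2 leaves eps / 2 < eps. *)
have e0 : 0 < eps / (2 * C) by rewrite divr_gt0// mulr_gt0.
(* A list of at most r directions contains at most r u-directions, so r serves for both bounds. *)
have [K uK HK] := separated_approx r r M0 e0 sH.
exists K => [g [lie_g gens_g]|]; first exact: (upoly_lie lie_g gens_g uK).
apply: (@le_lt_trans _ _ (C * (eps / (2 * C)))%:E).
  apply: CU => [||es esr z Uz]; [exact/smooth_sub/upoly_smooth|exact: ltW|].
  by apply: HK => //; [exact: leq_trans (count_size _ _) esr|exact: UM].
rewrite lte_fin (_ : C * _ = eps / 2); last by field; rewrite gt_eqF.
by rewrite ltr_pdivrMr// ltr_pMr// ltr1n.
Qed.
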